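(* Let $\mathcal B=(e_n)_{n=1}^\infty$ be a basis in a Banach space $\mathbb X$ over $\mathbb F\in\{\mathbb R,\mathbb C\}$, and assume that $\mathcal B$ is $\rho$-admissible (for some $\rho\ge1$). Then $\mathcal B$ is semi-greedy if and only if $\mathcal B$ is quasi-greedy and disjoint-super-democratic.
   Context: Basis: a sequence $\mathcal B=(e_n)_{n\ge1}$ in $\mathbb X$ with biorthogonal functionals $(e_n^* )_{n\ge1}\subset\mathbb X^*$ which is a semi-normalized strong Markushevich basis, i.e. (a) $0<\inf_n\{\|e_n\|,\|e_n^*\|\}\le\sup_n\{\|e_n\|,\|e_n^*\|\}<\infty$; (b) $e_j^*(e_i)=\delta_{j,i}$; (c) $\mathbb X=\overline{\mathrm{span}}\{e_i:i\in\mathbb N\}$; (d) if $e_j^*(x)=0$ for all $j$ then $x=0$; (e) for every $A\subset\mathbb N$, $\overline{\mathrm{span}}\{e_i:i\in A\}=\{x\in\mathbb X: e_j^*(x)=0\ \forall j\notin A\}$. For $\rho\ge1$, $(e_n)$ is $\rho$-admissible if for each finite set $A\subset\mathbb N$ there exists $n_0=n_0(A)$ such that, for all sets $B\subset\mathbb N$ with $\min B\ge n_0$ and $|B|\le|A|$, $\|\sum_{n\in A}\alpha_ne_n\|\le\rho\,\|\sum_{n\in A\cup B}\alpha_ne_n\|$ for all scalars $\alpha_n\in\mathbb F$. A sign is a sequence $\varepsilon=(\varepsilon_n)$ of scalars in $\mathbb F$ with $|\varepsilon_n|=1$; for finite $A\subset\mathbb N$, $\mathbf 1_{\varepsilon A}=\sum_{n\in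 A}\varepsilon_ne_n$. Greedy sums: for $x\in\mathbb X$, the natural greedy ordering lists indices so that $|e_n^*(x)|$ is non-increasing, with ties broken by putting the smaller index first; $A_m(x)$ is the set of the first $m$ indices, and $\mathcal G_m(x)=\sum_{n\in A_m(x)}e_n^*(x)e_n$. The $m$-th Chebyshev-greedy sum $\mathcal{CG}_m(x)$ is any element of $\mathrm{span}\{e_i:i\in A_m(x)\}$ with $\|x-\mathcal{CG}_m(x)\|=\min\{\|x-\sum_{n\in A_m(x)}a_ne_n\|:a_n\in\mathbb F\}$. $\mathcal B$ is quasi-greedy if there is $C>0$ with $\|x-\mathcal G_m(x)\|\le C\|x\|$ for all $x\in\mathbb X$, $m\in\mathbb N$. $\mathcal B$ is semi-greedy if there is $C>0$ with $\|x-\mathcal{CG}_m(x)\|\le C\sigma_m(x)$ for all $x\in\mathbb X$, $m\in\mathbb N$, where $\sigma_m(x)=\inf\{\|x-\sum_{n\in A}a_ne_n\|:A\subset\mathbb N,\ |A|\le m,\ a_n\in\mathbb F\}$. $\mathcal B$ is disjoint-super-democratic if there is $C>0$ with $\|\mathbf 1_{\varepsilon A}\|\le C\|\mathbf 1_{\varepsilon'B}\|$ for all finite $A,B\subset\mathbb N$ with $|A|\le|B|$ and $A\cap B=\emptyset$, and all signs $\varepsilon,\varepsilon'$. *)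

(* Defs.v *)
From HB Require Import structures.
From mathcomp Require Import all_boot all_order all_algebra finmap.
From mathcomp Require Import all_classical all_reals ereal topology normedtype.
From mathcomp Require Import complex.

Set Implicit Arguments.
Unset Strict Implicit.
Unset Printing Implicit Defensive.

Import Order.TTheory GRing.Theory Num.Theory.
Import numFieldNormedType.Exports.

Local Open Scope classical_set_scope.
Local Open Scope ring_scope.

(* [real_or_complex re] says that the scalar field K is the field R of real
   numbers or the field R[i] of complex numbers, [re] being the real part.
   Norms in MathComp-Analysis take their values in the scalar field, which is
   only partially ordered for R[i]; composing with [re] gives the usual
   R-valued norm, for which infima and suprema make sense. *)
Variant real_or_complex (R : realType) :
    forall K : numFieldType, (K -> R) -> Prop :=
  | RealScalars : real_or_complex (fun x : R => x)
  | ComplexScalars : real_or_complex (fun z : R[i] => complex.Re z).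

Section Bases.
Variables (R : realType) (K : numFieldType) (re : K -> R).

Definition nrm (V : normedModType K) (x : V) : R := re `|x|.

Definition dual_nrm (V : normedModType K) (f : V -> K^o) : \bar R :=
  ereal_sup [set (nrm (f x))%:E | x in [set x : V | nrm x <= 1]].

Variables (X : completeNormedModType K).

(* Sequences are indexed from 0: [e n] stands for the basis vector of
   index n + 1. *)
Variables (e : nat -> X) (es : nat -> {linear X -> K^o}).

Definition lincomb (A : {fset nat}) (a : nat -> K) : X :=
  \sum_(n <- A) a n *: e n.

Definition span_of (A : set nat) : set X :=
  [set x | exists (F : {fset nat}) (a : nat -> K),
     [set` F] `<=` A /\ x = lincomb F a].

Definition basis_norms : set (\bar R) :=
  range (fun n => (nrm (e n))%:E) `|` range (fun n => dual_nrm (es n)).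

Record is_basis : Prop := IsBasis {
  basis_functional_continuous : forall n, continuous (es n) ;
  basis_inf_gt0 : (0 < ereal_inf basis_norms)%E ;
  basis_sup_finite : (ereal_sup basis_norms < +oo)%E ;
  basis_biorthogonal : forall i j, es j (e i) = (i == j)%:R ;
  basis_dense : closure (span_of setT) = setT ;
  basis_total : forall x, (forall j, es j x = 0) -> x = 0 ;
  basis_strong : forall A : set nat,
    closure (span_of A) = [set x | forall j, ~ A j -> es j x = 0] }.

Definition admissible (rho : R) : Prop :=
  forall A : {fset nat}, exists n0 : nat, forall B : {fset nat},
    (forall n, n \in B -> (n0 <= n)%N) -> (#|` B| <= #|` A|)%N ->
    forall a : nat -> K,
      nrm (lincomb A a) <= rho * nrm (lincomb (A `|` B)%fset a).

Definition is_sign (eps : nat -> K) : Prop := forall n, `|eps n| = 1.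

Definition coef_before (x : X) (i k : nat) : Prop :=
  nrm (es k x) < nrm (es i x) \/ (nrm (es i x) = nrm (es k x) /\ (i < k)%N).

(* [pi 0, pi 1, ...] is the natural greedy ordering of x. When x has
   infinitely many nonzero coefficients, the indices of zero coefficients are
   never reached; hence the second condition, which puts the unlisted indices
   after all the listed ones and makes [pi] unique. *)
Definition greedy_ordering (x : X) (pi : nat -> nat) : Prop :=
  (forall j k, (j < k)%N -> coef_before x (pi j) (pi k)) /\
  (forall n, ~ range pi n -> forall j, coef_before x (pi j) n).

Definition greedy_set (x : X) (m : nat) (A : {fset nat}) : Prop :=
  exists2 pi : nat -> nat, greedy_ordering x pi &
    A = [fset pi j | j in iota 0 m]%fset.

Definition is_greedy_sum (x : X) (m : nat) (y : X) : Prop :=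
  exists2 A : {fset nat}, greedy_set x m A & y = lincomb A (fun n => es n x).

Definition is_chebyshev_greedy_sum (x : X) (m : nat) (y : X) : Prop :=
  exists2 A : {fset nat}, greedy_set x m A &
    (exists a : nat -> K, y = lincomb A a) /\
    (forall a : nat -> K, nrm (x - y) <= nrm (x - lincomb A a)).

Definition quasi_greedy : Prop :=
  exists2 C : R, 0 < C & forall (x : X) (m : nat) (y : X),
    (0 < m)%N -> is_greedy_sum x m y -> nrm (x - y) <= C * nrm x.

Definition sigma (m : nat) (x : X) : R :=
  inf [set r | exists (A : {fset nat}) (a : nat -> K),
         (#|` A| <= m)%N /\ r = nrm (x - lincomb A a)].

Definition semi_greedy : Prop :=
  exists2 C : R, 0 < C & forall (x : X) (m : nat) (y : X),
    (0 < m)%N -> is_chebyshev_greedy_sum x m y ->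
    nrm (x - y) <= C * sigma m x.

Definition disjoint_super_democratic : Prop :=
  exists2 C : R, 0 < C & forall (A B : {fset nat}) (eps eps' : nat -> K),
    (#|` A| <= #|` B|)%N -> [disjoint A & B]%fset ->
    is_sign eps -> is_sign eps' ->
    nrm (lincomb A eps) <= C * nrm (lincomb B eps').

End Bases.

(* Main.v *)
(* From semi-greedy to the other two properties: let z be finitely supported
   on F and let d be supported on a set D far to the right of F, with
   |D| <= |F|.  If D is a strict greedy set of z + d, then the Chebyshev
   remainder of z + d is z plus a vector supported on D, so admissibility
   bounds z by rho times this remainder, hence by the distance of z + d to
   any |D|-term combination.  If instead some A in F with |A| >= |D| is a
   strict greedy set of z + d, removing d bounds the remainder by z and then
   admissibility bounds d.  Taking z to be signed indicators gives
   super-democracy; taking z = x - P_A x, then z = x, and d = alpha 1_D with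
   alpha separating the coefficients on A from the others gives
   quasi-greediness.

   Conversely, given x with greedy set A and threshold alpha, and an m-term
   combination z, truncate the coefficients of x - z at level alpha: this is
   bounded by x - z for a quasi-greedy basis (Abel summation).  Correct the
   result on B \ A, B being the support of z, so as to obtain x up to an
   element of the span of A; super-democracy bounds the correction, since
   |B \ A| <= |A \ B| and the coefficients of x - z on A \ B are at least
   alpha. *)

Require Import Defs.
From mathcomp Require Import all_boot all_order all_algebra finmap.
From mathcomp Require Import all_classical all_reals topology normedtype ereal.
From mathcomp Require Import derive complex ring lra.

Set Implicit Arguments.
Unset Strict Implicit.
Unset Printing Implicit Defensive.

Import Order.TTheory GRing.Theory Num.Theory.
Import numFieldNormedType.Exports.

Local Open Scope classical_set_scope.
Local Open Scope ring_scope.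

(** * Minima of Lipschitz functions of one scalar *)

Lemma lipschitz_min_segment (R : realType) (f : R -> R) (L r : R) :
  0 <= r -> (forall s t, f s - f t <= L * `|s - t|) ->
  exists2 t0, `|t0| <= r & forall t, `|t| <= r -> f t0 <= f t.
Proof.
move=> r0 fL.
have fc : continuous f.
  move=> s; apply/cvgrPdist_lt => eps eps0; near=> t.
  have L1 : 0 < `|L| + 1 by rewrite ltr_wpDl.
  have dst : `|s - t| < eps / (`|L| + 1).
    by near: t; apply: cvgr_dist_lt; rewrite ?divr_gt0.
  have le s' t' : f s' - f t' <= (`|L| + 1) * `|s' - t'|.
    apply: le_trans (fL _ _) _; apply: ler_wpM2r => //.
    by rewrite (le_trans (ler_norm _)) ?lerDl.
  apply: (@le_lt_trans _ _ ((`|L| + 1) * `|s - t|)).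
    by rewrite ler_norml lerNl opprB le andbT distrC le.
  by rewrite mulrC -ltr_pdivlMr.
have Nrr : - r <= r by lra.
have [t0 t0r t0min] := @EVT_min R f (- r) r Nrr (continuous_subspaceT fc).
exists t0; first by rewrite ler_norml; move: t0r; rewrite in_itv.
by move=> t tr; apply: t0min; rewrite in_itv -ler_norml.
Unshelve. all: by end_near.
Qed.

(* Q is a ball of real, or a square of complex scalars; for the square, one
   minimizes over the imaginary part first. *)
Lemma lipschitz_min_scalar (R : realType) (K : numFieldType) (re : K -> R)
    (hK : real_or_complex re) (r : R) : 0 <= r ->
  exists2 Q : set K, (forall z, re `|z| <= r -> Q z) &
    forall (f : K -> R) (L : R), (forall z w, f z - f w <= L * re `|z - w|) ->
    exists2 z0, Q z0 & forall z, Q z -> f z0 <= f z.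
Proof.
case: hK => r0.
  exists [set z | `|z| <= r] => // f L fL.
  by have [t0 ? ?] := lipschitz_min_segment r0 fL; exists t0.
exists [set z | `|complex.Re z| <= r /\ `|complex.Im z| <= r].
  move=> [a b]; rewrite normc_def /= => ab.
  split; apply: le_trans ab; rewrite -sqrtr_sqr; apply: ler_wsqrtr.
    by rewrite lerDl sqr_ge0.
  by rewrite lerDr sqr_ge0.
move=> f L fL.
have normRe (a : R) : complex.Re `|(a +i* 0)%C| = `|a|.
  by rewrite normc_def /= expr0n /= addr0 sqrtr_sqr.
have normIm (a : R) : complex.Re `|(0 +i* a)%C| = `|a|.
  by rewrite normc_def /= expr0n /= add0r sqrtr_sqr.
have /choice[g gP] (a : R) : exists b, `|b| <= r /\
    forall b', `|b'| <= r -> f (a +i* b)%C <= f (a +i* b')%C.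
  have [|b0 ? ?] := @lipschitz_min_segment R (fun b => f (a +i* b)%C) L r r0.
    move=> s t; apply: le_trans (fL _ _) _; rewrite -normIm.
    by rewrite (_ : (_ - _) = (0 +i* (s - t))%C) //;
      apply/eqP; rewrite eq_complex /= subrr !eqxx.
  by exists b0.
have [|a0 a0r a0min] :=
    @lipschitz_min_segment R (fun a => f (a +i* g a)%C) L r r0.
  move=> s t; have [_ /(_ (g t)) gs] := gP s; have [gt _] := gP t.
  apply: le_trans (lerB (gs gt) (lexx _)) _.
  apply: le_trans (fL _ _) _; rewrite -normRe.
  by rewrite (_ : (_ - _) = ((s - t) +i* 0)%C) //;
      apply/eqP; rewrite eq_complex /= subrr !eqxx.
exists (a0 +i* g a0)%C; first by split=> //=; case: (gP a0).
move=> [a b] [/= ar br]; apply: le_trans (a0min _ ar) _.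
by case: (gP a) => _; apply.
Qed.

(** Both scalar fields are handled at once through [ofR]; only the existence of minimizers over
    scalars returns to the two cases. *)
Lemma real_embedding (R : realType) (K : numFieldType) (re : K -> R)
    (hK : real_or_complex re) :
  exists ofR : {rmorphism R -> K}, [/\ forall r, re (ofR r) = r,
    forall z : K, ofR (re `|z|) = `|z| & {mono ofR : r s / r <= s}].
Proof.
case: hK; first by exists idfun.
exists (real_complex R); split=> // r s.
exact: lecR.
Qed.

(** * Real-valued norms *)

Section Norm.
Variables (R : realType) (K : numFieldType) (re : K -> R).
Variable ofR : {rmorphism R -> K}.
Hypothesis re_ofR : forall r, re (ofR r) = r.
Hypothesis ofR_norm : forall z : K, ofR (re `|z|) = `|z|.
Hypothesis ofR_le : {mono ofR : r s / r <= s}.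

Local Notation N := (nrm re).
Local Notation M a := (nrm re (a : K^o)).

Lemma ofR_nrm (V : normedModType K) (x : V) : ofR (N x) = `|x|.
Proof. by rewrite /nrm -[in LHS](normr_id x) ofR_norm normr_id. Qed.

Section NormedModule.
Variable V : normedModType K.
Implicit Types x y : V.

Lemma nrm_ge0 x : 0 <= N x.
Proof. by rewrite -ofR_le rmorph0 ofR_nrm. Qed.

Lemma nrm0 : N (0 : V) = 0.
Proof. by apply: (fmorph_inj ofR); rewrite ofR_nrm normr0 rmorph0. Qed.

Lemma nrm_eq0 x : N x = 0 -> x = 0.
Proof. by move=> Nx; apply: normr0_eq0; rewrite -ofR_nrm Nx rmorph0. Qed.

Lemma nrmN x : N (- x) = N x.
Proof. by rewrite /nrm normrN. Qed.

Lemma nrm_distC x y : N (x - y) = N (y - x).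
Proof. by rewrite /nrm distrC. Qed.

Lemma nrmD x y : N (x + y) <= N x + N y.
Proof. by rewrite -ofR_le rmorphD !ofR_nrm ler_normD. Qed.

Lemma nrmB x y : N (x - y) <= N x + N y.
Proof. by rewrite -(nrmN y) nrmD. Qed.

Lemma nrm_subD y x z : N (x - z) <= N (x - y) + N (y - z).
Proof. by rewrite -ofR_le rmorphD !ofR_nrm ler_distD. Qed.

Lemma nrmBB x y : N x - N y <= N (x - y).
Proof. by rewrite lerBlDr -{1}(subrK y x) nrmD. Qed.

Lemma nrmZ a x : N (a *: x) = M a * N x.
Proof. by apply: (fmorph_inj ofR); rewrite rmorphM !ofR_nrm normrZ. Qed.

Lemma nrm_sum (I : Type) (s : seq I) (P : pred I) (F : I -> V) :
  N (\sum_(i <- s | P i) F i) <= \sum_(i <- s | P i) N (F i).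
Proof.
elim/big_ind2: _ => //; first by rewrite nrm0.
by move=> x a y b xa yb; apply: le_trans (nrmD _ _) (lerD _ _).
Qed.

End NormedModule.

Lemma nrm_ofR r : M (ofR r) = `|r|.
Proof.
have pos s : 0 <= s -> M (ofR s) = s.
  by move=> s0; rewrite /nrm ger0_norm ?re_ofR // -(rmorph0 ofR) ofR_le.
have [r0|/ltW r0] := leP 0 r; first by rewrite pos // ger0_norm.
by rewrite ler0_norm // -nrmN -rmorphN pos // oppr_ge0.
Qed.

Lemma nrmM (a b : K) : M (a * b) = M a * M b.
Proof. by apply: (fmorph_inj ofR); rewrite rmorphM !ofR_nrm normrM. Qed.

(** The value [1] at [0] makes [sgnK] of any family of scalars a sign. *)
Definition sgnK (a : K) : K := if a == 0 then 1 else a / `|a|.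

Lemma norm_sgnK a : `|sgnK a| = 1.
Proof.
rewrite /sgnK; case: eqP => [_|/eqP a0]; first by rewrite normr1.
by rewrite normrM normfV normr_id divff ?normr_eq0.
Qed.

Lemma nrm_sgnK a : M (sgnK a) = 1.
Proof. by rewrite /nrm norm_sgnK -(rmorph1 ofR) re_ofR. Qed.

Lemma nrm_unit a : `|a| = 1 -> M a = 1.
Proof. by move=> a1; rewrite /nrm a1 -(rmorph1 ofR) re_ofR. Qed.

Lemma sgnK_mul a : ofR (M a) * sgnK a = a.
Proof.
rewrite ofR_nrm /sgnK; case: eqP => [->|/eqP a0]; first by rewrite normr0 mul0r.
by rewrite mulrC divfK ?normr_eq0.
Qed.

(* The left-hand side is a convex combination of the vectors bounded by the
   hypothesis. *)
Lemma nrm_convex (V : normedModType K) (s : seq nat) (f : nat -> V)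
    (t : nat -> R) (b : R) (v : V) :
  (forall n, 0 <= t n <= 1) ->
  (forall s', subseq s' s -> N (v + \sum_(n <- s') f n) <= b) ->
  N (v + \sum_(n <- s) ofR (t n) *: f n) <= b.
Proof.
move=> t01; elim: s v => [|m s IH] v vb.
  by have := vb [::]; rewrite !big_nil; apply.
have [t0 t1] := andP (t01 m).
have in1 : N (v + f m + \sum_(n <- s) ofR (t n) *: f n) <= b.
  apply: IH => s' s's; rewrite -addrA -(big_cons _ _ _ _ xpredT).
  by apply: vb; rewrite /= eqxx.
have in0 : N (v + \sum_(n <- s) ofR (t n) *: f n) <= b.
  by apply: IH => s' s's; apply: vb; apply: subseq_trans s's (subseq_cons _ _).
set w := \sum_(n <- s) _ in in0 in1.
have -> : v + \sum_(n <- m :: s) ofR (t n) *: f n =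
    ofR (t m) *: (v + f m + w) + ofR (1 - t m) *: (v + w).
  rewrite big_cons -/w rmorphB rmorph1 scalerBl scale1r (addrAC v) scalerDr.
  by rewrite (addrC (_ *: (v + w))) -addrA subrKC addrCA.
apply: le_trans (nrmD _ _) _; rewrite !nrmZ !nrm_ofR !ger0_norm ?subr_ge0 //.
have -> : b = t m * b + (1 - t m) * b by rewrite -mulrDl subrKC mul1r.
by rewrite lerD ?ler_wpM2l ?subr_ge0.
Qed.

(* Abel summation: with [G n] the n-th partial sum,
   [sum_(i < n) t_i g_i - t_n G_n = - sum_(i < n) (t_(i+1) - t_i) G_(i+1)]. *)
Lemma nrm_abel (V : normedModType K) (g : nat -> V) (t : nat -> R) (b : R)
    (n : nat) :
  0 <= t 0 -> (forall i, t i <= t i.+1) ->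
  (forall i, N (\sum_(j < i) g j) <= b) ->
  N (\sum_(i < n) ofR (t i) *: g i) <= 2 * t n * b.
Proof.
move=> t0 tS gb.
have b0 : 0 <= b by have := gb 0; rewrite big_ord0 nrm0.
have tge0 i : 0 <= t i by elim: i => // i /le_trans; apply.
suff H : N (\sum_(i < n) ofR (t i) *: g i -
            ofR (t n) *: \sum_(i < n) g i) <= t n * b.
  set S := \sum_(i < n) ofR (t i) *: g i in H *.
  rewrite -(subrK (ofR (t n) *: \sum_(i < n) g i) S).
  apply: le_trans (nrmD _ _) _.
  rewrite nrmZ nrm_ofR ger0_norm // -mulrA mulr_natl mulr2n lerD //.
  by rewrite ler_wpM2l.
elim: n => [|n IH]; first by rewrite !big_ord0 scaler0 subr0 nrm0 mulr_ge0.
have -> : \sum_(i < n.+1) ofR (t i) *: g i - ofR (t n.+1) *: \sum_(i < n.+1) g i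
   = (\sum_(i < n) ofR (t i) *: g i - ofR (t n) *: \sum_(i < n) g i)
     - ofR (t n.+1 - t n) *: \sum_(i < n.+1) g i.
  rewrite rmorphB scalerBl opprB addrA; congr (_ - _).
  by rewrite !big_ord_recr /= scalerDr addrA subrK.
apply: le_trans (nrmB _ _) _; rewrite nrmZ nrm_ofR ger0_norm ?subr_ge0 //.
have -> : t n.+1 * b = t n * b + (t n.+1 - t n) * b by rewrite -mulrDl subrKC.
by rewrite lerD // ler_wpM2l // subr_ge0.
Qed.


(** * Greedy orderings and Chebyshev-greedy sums *)

Section Basis.
Variables (X : completeNormedModType K) (e : nat -> X).
Variable es : nat -> {linear X -> K^o}.
Hypothesis he : is_basis re e es.

Local Notation coef x n := (nrm re (es n x)).

Lemma coef_lincomb j A (a : nat -> K) :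
  es j (lincomb e A a) = if j \in A then a j else 0.
Proof.
rewrite /lincomb linear_sum.
under eq_bigr do rewrite linearZ /= (basis_biorthogonal he).
case: ifPn => [jA|jA].
  rewrite (bigD1_seq j) ?fset_uniq //= eqxx big1 ?addr0 => [|i /negPf ->].
    exact: mulr1.
  exact: mulr0.
rewrite big1_seq // => i /= iA; case: eqP => [ij|_]; last exact: mulr0.
by rewrite -ij iA in jA.
Qed.

Lemma eq_coef (x y : X) : (forall j, es j x = es j y) -> x = y.
Proof.
move=> xy; apply/eqP; rewrite -subr_eq0; apply/eqP; apply: (basis_total he).
by move=> j; rewrite linearB /= xy subrr.
Qed.

(** Scaling [x] to norm one turns the finite supremum of the dual norms into a bound uniform in
    [n]. *)
Lemma coef_le : exists2 C : R, 0 < C & forall n x, coef x n <= C * N x.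
Proof.
set s := ereal_sup (basis_norms re e es).
have ups n (y : X) : N y <= 1 -> ((coef y n)%:E <= s)%E.
  move=> y1; apply: (@le_trans _ _ (dual_nrm re (es n))).
    by apply: ereal_sup_ubound; exists y.
  by apply: ereal_sup_ubound; right; exists n.
have : (s < +oo)%E := basis_sup_finite he.
have N01 : N (0 : X) <= 1 by rewrite nrm0.
case: s ups => [r| |] // ups _; last by have := ups 0 0 N01.
exists (`|r| + 1); first by rewrite ltr_wpDl.
move=> n x; have [x0|x0] := eqVneq x 0.
  by rewrite x0 linear0 !nrm0 mulr0.
have Nx : 0 < N x.
  rewrite lt_def nrm_ge0 andbT; apply: contra x0 => /eqP /nrm_eq0 ->.
  exact: eqxx.
have := ups n (ofR (N x)^-1 *: x).
rewrite linearZ /= !nrmZ nrm_ofR gtr0_norm ?invr_gt0 // mulVf ?gt_eqF //.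
move=> /(_ (lexx _)); rewrite lee_fin mulrC ler_pdivrMr // => /le_trans; apply.
by rewrite ler_wpM2r ?nrm_ge0 // (le_trans (ler_norm _)) ?lerDl.
Qed.

Lemma dense_lincomb (x : X) eps : 0 < eps ->
  exists F a, N (x - lincomb e F a) < eps.
Proof.
move=> eps0; have : closure (span_of e setT) x by rewrite (basis_dense he).
have oeps : 0 < ofR eps by rewrite -(rmorph0 ofR) (leW_mono ofR_le).
move=> /(_ _ (nbhsx_ballx x _ oeps)) [_ [[F [a [_ ->]]]]].
rewrite -ball_normE /= => xF; exists F, a.
by rewrite -(leW_mono ofR_le) ofR_nrm.
Qed.

(** Outside the support of a finite combination within [eps / C] of [x], all coefficients of [x] are
    below [eps]. *)
Lemma coef_level (x : X) eps : 0 < eps ->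
  exists F : {fset nat}, forall n, (n \in F) = (eps <= coef x n).
Proof.
move=> eps0; have [C C0 cC] := coef_le.
have [F [a xF]] := dense_lincomb x (divr_gt0 eps0 C0).
exists [fset n in F | eps <= coef x n]%fset => n; rewrite !inE /=.
apply: andb_idl; apply: contraTT => nF; rewrite -ltNge.
have -> : es n x = es n (x - lincomb e F a).
  by rewrite linearB /= coef_lincomb (negPf nF) subr0.
apply: le_lt_trans (cC _ _) _.
by rewrite mulrC -ltr_pdivlMr.
Qed.

(** * The natural greedy ordering of a vector *)

Section Ordering.
Variable x : X.

Lemma coef_before_trans i j k :
  coef_before re es x i j -> coef_before re es x j k -> coef_before re es x i k.
Proof.
rewrite /coef_before => -[ij|[ij ij']] [jk|[jk jk']].
- by left; apply: lt_trans jk ij.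
- by left; rewrite -jk.
- by left; rewrite ij.
- by right; rewrite ij jk (ltn_trans ij').
Qed.

Lemma coef_before_irr i : ~ coef_before re es x i i.
Proof. by rewrite /coef_before ltxx ltnn => -[|[]]. Qed.

Lemma coef_before_total i j : i != j ->
  coef_before re es x i j \/ coef_before re es x j i.
Proof.
rewrite /coef_before; case: (ltgtP (coef x i) (coef x j)) => [||ij].
- by right; left.
- by left; left.
- by rewrite neq_ltn => /orP[] ?; [left|right]; right.
Qed.

Lemma coef_before_min_seq (s : seq nat) : s != [::] ->
  exists2 i, i \in s & forall k, k \in s -> k != i -> coef_before re es x i k.
Proof.
elim: s => // m s IH _; have [->|/IH[i iS imin]] := eqVneq s [::].
  by exists m; rewrite ?inE // => k; rewrite inE => /eqP ->; rewrite eqxx.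
have [im|im] := eqVneq i m.
  exists i; first by rewrite inE iS orbT.
  move=> k; rewrite inE => /orP[/eqP ->|/imin//]; by rewrite -im eqxx.
have [bim|bmi] := coef_before_total im.
  exists i; first by rewrite inE iS orbT.
  by move=> k; rewrite inE => /orP[/eqP ->|/imin].
exists m; first by rewrite inE eqxx.
move=> k; rewrite inE => /orP[/eqP ->|kS km]; first by rewrite eqxx.
have [-> //|ki] := eqVneq k i.
exact: coef_before_trans bmi (imin _ kS ki).
Qed.

(* The coefficients of x tend to zero, so [coef_before] is a well-order. *)
Lemma coef_before_min (P : pred nat) : (exists n, P n) ->
  exists2 i, P i & forall k, P k -> k != i -> coef_before re es x i k.
Proof.
(* If some index in [P] has a nonzero coefficient, the minimum lies in a finite level set; otherwise
   all coefficients on [P] vanish and the least index wins the ties. *)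
move=> exP; have [[i Pi i0]|Z] := pselect (exists2 i, P i & 0 < coef x i).
  have [F FE] := coef_level x i0.
  have iF : i \in [seq n <- F | P n] by rewrite mem_filter Pi FE lexx.
  have [|j] := @coef_before_min_seq [seq n <- F | P n].
    by apply: contraTneq iF => ->.
  rewrite mem_filter => /andP[Pj jF] jmin; exists j => // k Pk kj.
  have [kF|kF] := boolP (k \in F).
    by apply: jmin => //; rewrite mem_filter Pk.
  left; apply: (@lt_le_trans _ _ (coef x i)); last by rewrite -FE.
  by rewrite ltNge -FE.
have Z0 n : P n -> coef x n = 0.
  move=> Pn; apply/eqP; rewrite eq_le nrm_ge0 andbT leNgt.
  by apply/negP => n0; apply: Z; exists n.
exists (ex_minn exP); first by case: ex_minnP.
case: ex_minnP => i Pi imin k Pk ki; right; rewrite !Z0 //; split=> //.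
by rewrite ltn_neqAle eq_sym ki imin.
Qed.

Lemma greedy_ordering_exists : exists pi, greedy_ordering re es x pi.
Proof.
(* [f L] is the first index outside the list [L]; the ordering arises by appending it over and
   over. *)
have /choice[f fP] (L : seq nat) : exists i : nat, i \notin L /\
    forall k : nat, k \notin L -> k != i -> coef_before re es x i k.
  have [|i iL imin] := @coef_before_min (fun n => n \notin L); last by exists i.
  exists (\max_(i <- L) i).+1; apply/negP => iL.
  by have := @leq_bigmax_seq _ L xpredT id _ iL isT; rewrite ltnn.
pose L k := iter k (fun L => rcons L (f L)) [::].
pose pi k := f (L k).
have memL k n : n \in L k <-> exists2 j, (j < k)%N & n = pi j.
  elim: k => [|k IH]; first by split=> [//|[]].
  rewrite /= mem_rcons inE; split.
    by case/orP => [/eqP ->|/IH[j jk ->]]; [exists k|exists j => //; apply: ltnW].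
  case=> j; rewrite ltnS leq_eqVlt => /orP[/eqP -> ->|jk nj].
    by rewrite eqxx.
  by apply/orP; right; apply/IH; exists j.
have piL k : pi k \notin L k by case: (fP (L k)).
exists pi; split=> [j k jk|n nr j]; have [_] := fP (L j); apply.
- apply: contra (piL k) => /memL[i ij ->]; apply/memL; exists i => //.
  exact: ltn_trans jk.
- by apply: contraNneq (piL k) => E; apply/memL; exists j.
- by apply/negP => /memL[i _ E]; apply: nr; exists i.
- by apply/negP => /eqP E; apply: nr; exists j.
Qed.

Section Given.
Variable pi : nat -> nat.
Hypothesis piP : greedy_ordering re es x pi.

Lemma greedy_ordering_inj : injective pi.
Proof.
move=> i j E; case: (ltngtP i j) => // ij; have := piP.1 _ _ ij.
  by rewrite E => /coef_before_irr.
by rewrite E => /coef_before_irr.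
Qed.

Lemma card_greedy_prefix m : #|` [fset pi j | j in iota 0 m]%fset| = m.
Proof.
rewrite card_imfset /=; last exact: greedy_ordering_inj.
by rewrite undup_id ?iota_uniq ?size_iota.
Qed.

(** By cardinality it suffices that the prefix lies in [A]. If some [pi j] in it did not, all of [A]
    would be listed before position [j], forcing [|A| <= j]. *)
Lemma strict_greedy_prefix (A : {fset nat}) :
  (forall n k, n \in A -> k \notin A -> coef x k < coef x n) ->
  A = [fset pi j | j in iota 0 #|` A|]%fset.
Proof.
move=> strict; apply/eqP; rewrite eq_sym eqEfcard card_greedy_prefix leqnn andbT.
apply/fsubsetP => n /imfsetP[/= j]; rewrite mem_iota /= add0n => jA ->.
apply: contraLR (jA) => piA; rewrite -leqNgt.
rewrite -[leqRHS]card_greedy_prefix; apply: fsubset_leq_card.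
apply/fsubsetP => k kA.
have nb : ~ coef_before re es x (pi j) k.
  have lt := strict _ _ kA piA; move=> [gt|[E _]].
    by have := lt_trans lt gt; rewrite ltxx.
  by rewrite E ltxx in lt.
have [i _ E] : range pi k by apply: contrapT => /piP.2/(_ j).
apply/imfsetP; exists i => //=; rewrite mem_iota /= add0n.
rewrite ltnNge leq_eqVlt; apply/negP => /orP[/eqP ji|ji].
  by rewrite ji E kA in piA.
by apply: nb; rewrite -E; apply: piP.1.
Qed.

End Given.

Lemma strict_greedy_set (A : {fset nat}) :
  (forall n k, n \in A -> k \notin A -> coef x k < coef x n) ->
  greedy_set re es x #|` A| A.
Proof.
have [pi piP] := greedy_ordering_exists.
by exists pi => //; apply: strict_greedy_prefix.
Qed.

(** The threshold is the modulus of the first coefficient left out, at position [m]. *)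
Lemma greedy_set_level m (A : {fset nat}) : greedy_set re es x m A ->
  #|` A| = m /\ exists alpha, [/\ 0 <= alpha,
    forall n, n \in A -> alpha <= coef x n &
    forall n, n \notin A -> coef x n <= alpha].
Proof.
move=> [pi piP ->]; split; first exact: card_greedy_prefix.
have le i k : coef_before re es x i k -> coef x k <= coef x i.
  by move=> [/ltW//|[->]].
exists (coef x (pi m)); split; first exact: nrm_ge0.
  move=> n /imfsetP[/= j]; rewrite mem_iota => /andP[_ jm] ->.
  by apply: le; apply: piP.1.
move=> n nA; have [[i _ E]|nr] := pselect (range pi n); last first.
  by apply: le; apply: piP.2.
have : (m <= i)%N.
  rewrite leqNgt; apply: contra nA => im; apply/imfsetP; exists i => //=.
  by rewrite mem_iota.
by rewrite -E leq_eqVlt => /orP[/eqP ->//|mi]; apply: le; apply: piP.1.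
Qed.

End Ordering.

(** * Existence of Chebyshev-greedy sums *)

Section Chebyshev.
Hypothesis hK : real_or_complex re.

(* Minimizing over one coordinate leaves a function of the remaining vector
   that is again 1-Lipschitz, which allows an induction on s. *)
Lemma box_best_approx (Q : set K) (s : seq nat) (phi : X -> R) (x : X) :
  (forall (f : K -> R) (L : R), (forall z w, f z - f w <= L * re `|z - w|) ->
    exists2 z0, Q z0 & forall z, Q z -> f z0 <= f z) ->
  (forall y w, phi y - phi w <= N (y - w)) -> uniq s ->
  exists a : nat -> K, forall b, (forall n, Q (b n)) ->
    phi (x - \sum_(n <- s) a n *: e n) <= phi (x - \sum_(n <- s) b n *: e n).
Proof.
move=> Qmin; elim: s phi => [|m s IH] phi phiL /=.
  by exists (fun=> 0) => b _; rewrite !big_nil.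
move=> /andP[ms us].
have /choice[g gP] (y : X) : exists z, Q z /\
    forall w, Q w -> phi (y - z *: e m) <= phi (y - w *: e m).
  have [|z0 ? ?] := Qmin (fun z => phi (y - z *: e m)) (N (e m)).
    move=> z w; apply: le_trans (phiL _ _) _.
    rewrite opprB addrC subrKA -scalerBl nrmZ mulrC.
    by rewrite /nrm distrC.
  by exists z0.
have [|a aP] := IH (fun y => phi (y - g y *: e m)) _ us.
  move=> y w; have [_ /(_ (g w))] := gP y; have [gw _] := gP w => /(_ gw) le.
  apply: le_trans (lerB le (lexx _)) _; apply: le_trans (phiL _ _) _.
  by rewrite opprB addrA subrK.
(* The coordinate along [e m] is chosen last, as an optimal one for the remainder left by [s]. *)
exists (fun n => if n == m then g (x - \sum_(n <- s) a n *: e n) else a n).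
move=> b bQ; rewrite !big_cons eqxx.
have -> : \sum_(n <- s)
    (if n == m then g (x - \sum_(k <- s) a k *: e k) else a n) *: e n =
    \sum_(n <- s) a n *: e n.
  by apply: eq_big_seq => n ns; case: eqP ns ms => // -> ->.
rewrite ![_ *: e m + _]addrC !opprD !addrA.
apply: le_trans (aP _ bQ) _.
by have [_] := gP (x - \sum_(n <- s) b n *: e n); apply.
Qed.

(** A combination at least as good as zero has norm at most [2 * N x], so its coefficients lie in
    the bounded set [Q]; any other combination is beaten by zero. *)
Lemma best_approx_exists (x : X) (A : {fset nat}) :
  exists a, forall b, N (x - lincomb e A a) <= N (x - lincomb e A b).
Proof.
have [C C0 cC] := coef_le.
have r0 : 0 <= C * (N x + N x) by rewrite mulr_ge0 ?addr_ge0 ?nrm_ge0 ?ltW.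
have [Q Qr Qmin] := lipschitz_min_scalar hK r0.
have [a aP] := box_best_approx x Qmin (@nrmBB _) (fset_uniq A).
have Q0 : Q 0.
  apply: Qr; have -> : re `|0 : K| = N (0 : X) by rewrite /nrm !normr0.
  by rewrite nrm0.
exists a => b; have [le|/ltW gt] := lerP (N (x - lincomb e A b)) (N x); last first.
  apply: le_trans gt; have := aP (fun=> 0) (fun=> Q0).
  by rewrite [X in _ <= N (_ - X)]big1 ?subr0 // => n _; rewrite scale0r.
have -> : lincomb e A b = lincomb e A (fun n => if n \in A then b n else 0).
  by apply: eq_big_seq => n ->.
apply: aP => n; case: ifPn => // nA; apply: Qr.
have -> : re `|b n| = coef (lincomb e A b) n by rewrite coef_lincomb nA.
apply: le_trans (cC _ _) _; rewrite ler_pM2l //.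
rewrite -[lincomb e A b](subKr x); apply: le_trans (nrmB _ _) _.
by rewrite lerD2l.
Qed.

Lemma chebyshev_greedy_sum_exists (x : X) m (A : {fset nat}) :
  greedy_set re es x m A ->
  exists2 a, is_chebyshev_greedy_sum re e es x m (lincomb e A a) &
    forall b, N (x - lincomb e A a) <= N (x - lincomb e A b).
Proof.
move=> xA; have [a aP] := best_approx_exists x A.
by exists a => //; exists A => //; split; first by exists a.
Qed.

End Chebyshev.
(** * From quasi-greedy and super-democratic to semi-greedy *)

Definition proj (A : {fset nat}) (x : X) : X := lincomb e A (fun n => es n x).

Lemma coef_proj j A x : es j (proj A x) = if j \in A then es j x else 0.
Proof. exact: coef_lincomb. Qed.

Lemma projB A x y : proj A (x - y) = proj A x - proj A y.
Proof.
apply: eq_coef => j; rewrite !linearB /= !coef_proj.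
by case: ifP => _; rewrite ?linearB ?subr0.
Qed.

Lemma lincombZ A (a : nat -> K) c :
  lincomb e A (fun n => c * a n) = c *: lincomb e A a.
Proof. by rewrite /lincomb scaler_sumr; under eq_bigr do rewrite -scalerA. Qed.

Lemma far_fset n0 k : exists2 D : {fset nat}, #|` D| = k &
  forall n, n \in D -> (n0 <= n)%N.
Proof.
exists [fset i in iota n0 k]%fset.
  by rewrite card_imfset //= undup_id ?iota_uniq ?size_iota.
by move=> n; rewrite !inE /= mem_iota => /andP[].
Qed.

Lemma disjoint_bound (F : {fset nat}) :
  exists n0, forall n, (n0 <= n)%N -> n \notin F.
Proof.
exists (\max_(i <- F) i).+1 => n; apply: contraTN => nF.
by rewrite -leqNgt; exact: (@leq_bigmax_seq _ (F : seq nat) xpredT id _ nF isT).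
Qed.

Section SuperDemocratic.
Variable C : R.
Hypothesis C0 : 0 < C.
Hypothesis dsd : forall (A B : {fset nat}) (eps eps' : nat -> K),
  (#|` A| <= #|` B|)%N -> [disjoint A & B]%fset ->
  is_sign eps -> is_sign eps' ->
  N (lincomb e A eps) <= C * N (lincomb e B eps').

(* The two sets are compared through a third one, disjoint from both. *)
Lemma super_democratic (A B : {fset nat}) (eps eps' : nat -> K) :
  (#|` A| <= #|` B|)%N -> is_sign eps -> is_sign eps' ->
  N (lincomb e A eps) <= C * C * N (lincomb e B eps').
Proof.
move=> AB eps1 eps1'; have [n0 n0P] := disjoint_bound (A `|` B)%fset.
have [D DA Dn0] := far_fset n0 #|` A|.
have DAB n : n \in D -> n \notin A /\ n \notin B.
  by move=> /Dn0 /n0P; rewrite inE negb_or => /andP.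
apply: (le_trans (dsd (B := D) _ _ eps1 eps1)); rewrite ?DA //.
  by apply/fdisjointP_sym => n /DAB[].
rewrite -mulrA ler_pM2l //; apply: dsd; rewrite ?DA //.
by apply/fdisjointP => n /DAB[].
Qed.

(** The left-hand side is a convex combination of [r] times signed indicators of subsets of [D],
    each controlled by super-democracy. *)
Lemma super_democratic_le (D B : {fset nat}) (b eps' : nat -> K) r :
  (#|` D| <= #|` B|)%N -> is_sign eps' -> 0 < r ->
  (forall n, n \in D -> M (b n) <= r) ->
  N (lincomb e D b) <= r * (C * C * N (lincomb e B eps')).
Proof.
move=> DB eps1 r0 br.
(* The default [0] keeps the weights in [[0, 1]] outside [D], where nothing bounds [b]. *)
pose t n := if n \in D then M (b n) / r else 0.
pose f n := (ofR r * sgnK (b n)) *: e n.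
have -> : lincomb e D b = \sum_(n <- D) ofR (t n) *: f n.
  apply: eq_big_seq => n nD; rewrite /t nD scalerA mulrA -rmorphM.
  by rewrite divfK ?gt_eqF // sgnK_mul.
rewrite -[\sum_(n <- D) _]add0r; apply: nrm_convex => [n|s sD].
  rewrite /t; case: ifP => [nD|_]; last by rewrite lexx ler01.
  rewrite divr_ge0 ?nrm_ge0 ?(ltW r0) //=.
  by rewrite ler_pdivrMr // mul1r br.
have us : uniq s := subseq_uniq sD (fset_uniq D).
have -> : 0 + \sum_(n <- s) f n =
    ofR r *: lincomb e [fset n in s]%fset (fun n => sgnK (b n)).
  rewrite add0r -lincombZ; apply: perm_big; apply: uniq_perm => // [|n].
    exact: fset_uniq.
  by rewrite !inE.
rewrite nrmZ nrm_ofR gtr0_norm // ler_pM2l //.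
apply: super_democratic => //; last by move=> n; apply: norm_sgnK.
apply: leq_trans DB; apply: fsubset_leq_card; apply/fsubsetP => n.
by rewrite !inE; apply: mem_subseq.
Qed.

End SuperDemocratic.

(** * Truncation in quasi-greedy bases *)

Section QuasiGreedy.
Variable C : R.
Hypothesis C0 : 0 < C.
Hypothesis qg : forall (x : X) (m : nat) (y : X),
  (0 < m)%N -> is_greedy_sum re e es x m y -> N (x - y) <= C * N x.

(** [C + 2] bounds the greedy partial sums; the factor [2] comes from Abel summation. *)
Let G := 2 * (C + 2).

(** Taking [C + 1] in place of [C] covers the empty prefix. *)
Lemma quasi_greedy_prefix (x : X) pi m : greedy_ordering re es x pi ->
  N (x - proj [fset pi j | j in iota 0 m]%fset x) <= (C + 1) * N x.
Proof.
move=> piP; have [->|m0] := posnP m.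
  have -> : proj [fset pi j | j in iota 0 0]%fset x = 0.
    apply: eq_coef => j; rewrite coef_proj linear0.
    by case: ifP => // /imfsetP[].
  by rewrite subr0 ler_peMl ?nrm_ge0 // lerDr ltW.
apply: le_trans (qg m0 _) _; last by rewrite ler_wpM2r ?nrm_ge0 // lerDl ler01.
by exists [fset pi j | j in iota 0 m]%fset => //; exists pi.
Qed.

(** [F] is a prefix of the greedy ordering, and the signs arise from the terms of [x] through the
    weights [1 / |es n x|], which are nondecreasing along it; Abel summation applies. *)
Lemma sgn_level_le (x : X) (F : {fset nat}) alpha : 0 < alpha ->
  (forall n, (n \in F) = (alpha <= coef x n)) ->
  alpha * N (lincomb e F (fun n => sgnK (es n x))) <= G * N x.
Proof.
move=> alpha0 FE; have [pi piP] := greedy_ordering_exists x.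
have strict n k : n \in F -> k \notin F -> coef x k < coef x n.
  by rewrite !FE -ltNge => an /lt_le_trans; apply.
have pinj := greedy_ordering_inj piP.
have prefixE m (a : nat -> K) :
    lincomb e [fset pi j | j in iota 0 m]%fset a =
    \sum_(i < m) a (pi i) *: e (pi i).
  rewrite /lincomb big_imfset /=; last by move=> i j _ _; apply: pinj.
  by rewrite undup_id ?iota_uniq // -(big_mkord xpredT (fun i => a (pi i) *: e (pi i)))
    /index_iota subn0.
(* On [F] the maximum is the coefficient itself; beyond [F] the floor [alpha] avoids division by
   zero and keeps the weights at most [1 / alpha]. *)
pose t i := (Num.max (coef x (pi i)) alpha)^-1.
have max0 i : 0 < Num.max (coef x (pi i)) alpha by rewrite lt_max alpha0 orbT.
have FP := strict_greedy_prefix piP strict.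
have piF i : (i < #|` F|)%N -> pi i \in F.
  by move=> iF; rewrite FP; apply/imfsetP; exists i => //=; rewrite mem_iota.
have -> : lincomb e F (fun n => sgnK (es n x)) =
    \sum_(i < #|` F|) ofR (t i) *: (es (pi i) x *: e (pi i)).
  rewrite {1}FP prefixE; apply: eq_bigr => i _; rewrite scalerA; congr (_ *: _).
  have := piF i (ltn_ord i); rewrite FE => ai.
  rewrite /t max_l // fmorphV ofR_nrm /sgnK mulrC.
  case: eqP => // x0; move: (lt_le_trans alpha0 ai).
  by rewrite x0 nrm0 ltxx.
have tS i : t i <= t i.+1.
  rewrite /t lef_pV2 ?posrE // ge_max !le_max lexx orbT andbT.
  by have [/ltW ->//|[-> _]] := piP.1 _ _ (ltnSn i); rewrite lexx.
have sums i : N (\sum_(j < i) es (pi j) x *: e (pi j)) <= (C + 2) * N x.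
  rewrite -(prefixE i (fun n => es n x)) -[lincomb _ _ _](subKr x).
  apply: le_trans (nrmB _ _) _.
  have := quasi_greedy_prefix i piP; rewrite /proj; lra.
have t0 : 0 <= t 0 by rewrite invr_ge0 ltW.
have b0 : 0 <= (C + 2) * N x.
  by rewrite mulr_ge0 ?nrm_ge0 // addr_ge0 // ltW.
have := @nrm_abel X (fun i => es (pi i) x *: e (pi i)) t _ #|` F| t0 tS sums.
have tle : t #|` F| <= alpha^-1.
  by rewrite lef_pV2 ?posrE // le_max lexx orbT.
move=> le; rewrite mulrC -ler_pdivlMr //; apply: le_trans le _.
rewrite (_ : G * _ / _ = 2 * alpha^-1 * ((C + 2) * N x)); last by rewrite /G; ring.
by rewrite ler_wpM2r // ler_pM2l.
Qed.

(** The vector on the left is [x] with its large coefficients cut down to modulus [alpha]; the level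
    set [F] is a greedy set of [x]. *)
Lemma truncation_le (x : X) (F : {fset nat}) alpha : 0 < alpha ->
  (forall n, (n \in F) = (alpha <= coef x n)) ->
  N (x - proj F x + ofR alpha *: lincomb e F (fun n => sgnK (es n x))) <=
  (C + 1 + G) * N x.
Proof.
move=> alpha0 FE; apply: le_trans (nrmD _ _) _; rewrite mulrDl lerD //.
  have [pi piP] := greedy_ordering_exists x.
  rewrite (@strict_greedy_prefix x pi piP F); first exact: quasi_greedy_prefix.
  by move=> n k; rewrite !FE -ltNge => an /lt_le_trans; apply.
by rewrite nrmZ nrm_ofR gtr0_norm // sgn_level_le.
Qed.

(** In the constant, [C + 1 + G] pays for truncating [x - lincomb e B b], and the last summand for
    the correction on [B] minus [A]. *)
Lemma chebyshev_le (Cd : R) (x y : X) m : 0 < Cd ->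
  (forall (A B : {fset nat}) (eps eps' : nat -> K),
    (#|` A| <= #|` B|)%N -> [disjoint A & B]%fset ->
    is_sign eps -> is_sign eps' ->
    N (lincomb e A eps) <= Cd * N (lincomb e B eps')) ->
  is_chebyshev_greedy_sum re e es x m y ->
  forall (B : {fset nat}) (b : nat -> K), (#|` B| <= m)%N ->
  N (x - y) <= (C + 1 + G + 2 * (Cd * Cd) * G) * N (x - lincomb e B b).
Proof.
move=> Cd0 dsd [A xA [_ ymin]] B b Bm.
have [Am [alpha [alpha0 Aalpha outA]]] := greedy_set_level xA.
set z := x - lincomb e B b.
have G0 : 0 < G by do ?[apply: addr_gt0 | apply: mulr_gt0].
have CC0 : 0 < Cd * Cd by rewrite mulr_gt0.
(* When [alpha = 0], [x] is supported on [A] and the remainder vanishes. *)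
have [az|alpha_gt0] := eqVneq alpha 0.
  have -> : N (x - y) = 0.
    apply/eqP; rewrite eq_le nrm_ge0 andbT; apply: le_trans (ymin (fun n => es n x)) _.
    have -> : x - lincomb e A (fun n => es n x) = 0; last by rewrite nrm0.
    apply/eqP; rewrite subr_eq0; apply/eqP; apply: eq_coef => j.
    rewrite coef_lincomb; case: ifPn => // /outA; rewrite az => le0.
    by apply: (@nrm_eq0 K^o); apply/eqP; rewrite eq_le le0 nrm_ge0.
  apply: mulr_ge0 (nrm_ge0 _); apply: ltW.
  by do ?[apply: addr_gt0 | apply: mulr_gt0].
have {alpha0 alpha_gt0} alpha0 : 0 < alpha by rewrite lt_def alpha_gt0.
have [F FE] := coef_level z alpha0.
pose S := lincomb e F (fun n => sgnK (es n z)).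
pose T := z - proj F z + ofR alpha *: S.
have Tj j : es j T = if j \in F then ofR alpha * sgnK (es j z) else es j z.
  rewrite linearD linearB linearZ /= coef_proj coef_lincomb.
  by case: ifP => _; rewrite ?subrr ?add0r // subr0 scaler0 addr0.
have Tle j : coef T j <= alpha.
  rewrite Tj; case: ifPn => [_|]; last by rewrite FE -ltNge => /ltW.
  by rewrite nrmM nrm_ofR nrm_sgnK mulr1 gtr0_norm.
have zj j : j \notin B -> es j z = es j x.
  by move=> jB; rewrite linearB /= coef_lincomb (negPf jB) subr0.
pose D := (B `\` A)%fset.
pose v := T + lincomb e D (fun n => es n x - es n T).
(* Off [A] and [B], [z] has the coefficients of [x], of modulus at most [alpha], and truncation
   leaves them unchanged; so [v] differs from [x] on [A] only. *)
have xv : x - lincomb e A (fun n => es n x - es n T) = v.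
  apply: eq_coef => j; rewrite linearB linearD /= !coef_lincomb in_fsetD.
  case: (boolP (j \in A)) => [jA|jA] /=; first by rewrite subKr addr0.
  rewrite subr0; case: (boolP (j \in B)) => [_|jB]; first by rewrite subrKC.
  rewrite addr0 Tj; case: ifPn => [|_]; last by rewrite zj.
  rewrite FE zj // => le; have -> : alpha = coef x j.
    by apply/eqP; rewrite eq_le le outA.
  by rewrite sgnK_mul.
apply: le_trans (ymin (fun n => es n x - es n T)) _.
rewrite xv; apply: le_trans (nrmD _ _) _.
rewrite [leRHS]mulrDl; apply: lerD; first exact: truncation_le.
have DF : (#|` D| <= #|` F|)%N.
  apply: (@leq_trans #|` (A `\` B)%fset|).
    have := cardfsID A B; have := cardfsID B A; rewrite (fsetIC B A) /D Am.
    by move=> AE BE; rewrite -(leq_add2l #|` (A `&` B)%fset|) AE BE.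
  apply: fsubset_leq_card; apply/fsubsetP => n; rewrite in_fsetD => /andP[nB nA].
  by rewrite FE zj // Aalpha.
(* Off [A] the coefficients of [x] and of [T] are both at most [alpha], hence the factor [2]. *)
apply: (@le_trans _ _ (2 * alpha * (Cd * Cd * N S))).
  apply: (super_democratic_le Cd0 dsd DF).
  - by move=> n; apply: norm_sgnK.
  - by rewrite mulr_gt0.
  - move=> n; rewrite in_fsetD => /andP[nA _]; apply: le_trans (nrmB _ _) _.
    have := outA _ nA; have := Tle n; lra.
rewrite (_ : 2 * alpha * _ = 2 * (Cd * Cd) * (alpha * N S)); last by ring.
rewrite -[leRHS]mulrA; apply: ler_wpM2l; first by apply: ltW; apply: mulr_gt0.
exact: sgn_level_le.
Qed.

End QuasiGreedy.

Lemma quasi_greedy_super_democratic_semi_greedy :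
  quasi_greedy re e es -> disjoint_super_democratic re e ->
  semi_greedy re e es.
Proof.
move=> [C C0 qg] [Cd Cd0 dsd].
set G := 2 * (C + 2); pose Ct := C + 1 + G + 2 * (Cd * Cd) * G.
have G0 : 0 < G by do ?[apply: addr_gt0 | apply: mulr_gt0].
have Ct0 : 0 < Ct by do ?[apply: addr_gt0 | apply: mulr_gt0].
exists Ct => // x m y _ ycheb.
rewrite mulrC -ler_pdivrMr //; apply: lb_le_inf.
  by exists (N (x - lincomb e fset0 (fun=> 0))), fset0, (fun=> 0).
move=> _ [B [b [Bm ->]]]; rewrite ler_pdivrMr // mulrC.
exact: (chebyshev_le C0 qg Cd0 dsd ycheb).
Qed.

(** * From semi-greedy to quasi-greedy and super-democratic *)

Section SemiGreedy.
Hypothesis hK : real_or_complex re.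
Variable rho : R.
Hypothesis rho1 : 1 <= rho.
Hypothesis adm : admissible re e rho.
Variable C : R.
Hypothesis C0 : 0 < C.
Hypothesis sg : forall (x : X) (m : nat) (y : X),
  (0 < m)%N -> is_chebyshev_greedy_sum re e es x m y ->
  N (x - y) <= C * sigma re e m x.

Let rho0 : 0 < rho. Proof. exact: lt_le_trans rho1. Qed.

(** The strict gap makes [A] the greedy set irrespective of tie-breaking. *)
Lemma semi_greedy_strict (x : X) (A B : {fset nat}) (b : nat -> K) :
  (0 < #|` A|)%N -> (#|` B| <= #|` A|)%N ->
  (forall n k, n \in A -> k \notin A -> coef x k < coef x n) ->
  exists a, N (x - lincomb e A a) <= C * N (x - lincomb e B b).
Proof.
move=> A0 BA /strict_greedy_set /(chebyshev_greedy_sum_exists hK)[a cheb _].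
exists a; apply: le_trans (sg A0 cheb) _; rewrite ler_pM2l //.
apply: ge_inf; last by exists B, b.
by exists 0 => _ [? [? [_ ->]]]; apply: nrm_ge0.
Qed.

(** Keeping separate families [f] and [d] allows the coefficients on [D] to be changed alone. *)
Definition far (F D : {fset nat}) : Prop :=
  (forall n, n \in D -> n \notin F) /\ forall f d : nat -> K,
    N (lincomb e F f) <= rho * N (lincomb e F f + lincomb e D d).

(** A common [D] is needed for super-democracy, where [A] is compared with [D] and [D] with [B]. *)
Lemma far_exists (F1 F2 : {fset nat}) k :
  (k <= #|` F1|)%N -> (k <= #|` F2|)%N ->
  exists D, [/\ #|` D| = k, far F1 D & far F2 D].
Proof.
have farF F : exists n0, forall D : {fset nat},
    (forall n, n \in D -> (n0 <= n)%N) -> (#|` D| <= #|` F|)%N -> far F D.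
  have [n0 n0P] := disjoint_bound F; have [n1 n1P] := adm F.
  exists (maxn n0 n1) => D Dn DF; have DnF n : n \in D -> n \notin F.
    by move=> /Dn; rewrite geq_max => /andP[/n0P].
  split=> // f d; pose a n := if n \in F then f n else d n.
  have -> : lincomb e F f = lincomb e F a.
    by apply: eq_big_seq => n nF; rewrite /a nF.
  have -> : lincomb e F a + lincomb e D d = lincomb e (F `|` D)%fset a.
    apply: eq_coef => j; rewrite linearD /= !coef_lincomb in_fsetU /a.
    case: (boolP (j \in F)) => [jF|jF] /=; last by rewrite add0r.
    by rewrite ifN ?addr0 //; apply: contraL jF => /DnF.
  by apply: n1P => // n /Dn; rewrite geq_max => /andP[].
move=> k1 k2; have [n1 far1] := farF F1; have [n2 far2] := farF F2.
have [D Dk Dn] := far_fset (maxn n1 n2) k; exists D; split=> //.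
  by apply: far1; rewrite ?Dk // => n /Dn; rewrite geq_max => /andP[].
by apply: far2; rewrite ?Dk // => n /Dn; rewrite geq_max => /andP[].
Qed.

Lemma semi_greedy_far (F B D : {fset nat}) (f b d : nat -> K) :
  far F D -> (0 < #|` D|)%N -> (#|` B| <= #|` D|)%N ->
  (forall n k, n \in D -> k \in F -> M (f k) < M (d n)) ->
  (forall n, n \in D -> 0 < M (d n)) ->
  N (lincomb e F f) <=
  rho * (C * N (lincomb e F f + lincomb e D d - lincomb e B b)).
Proof.
move=> [DF farD] D0 BD fd d0.
have [|c cP] := @semi_greedy_strict (lincomb e F f + lincomb e D d) D B b D0 BD.
  move=> n k nD kD; rewrite !linearD /= !coef_lincomb nD (negPf kD) addr0.
  rewrite (negPf (DF _ nD)) add0r.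
  by case: ifP => [kF|_]; rewrite ?nrm0; [apply: fd|apply: d0].
apply: le_trans (farD f (fun n => d n - c n)) _.
rewrite ler_pM2l //; apply: le_trans cP.
rewrite (_ : lincomb e D (fun n => d n - c n) = lincomb e D d - lincomb e D c).
  by rewrite addrA.
apply: eq_coef => j; rewrite linearB /= !coef_lincomb.
by case: ifP; rewrite ?subr0.
Qed.

Lemma semi_greedy_near (F A D : {fset nat}) (f d : nat -> K) :
  far F D -> (0 < #|` A|)%N -> (#|` D| <= #|` A|)%N -> (A `<=` F)%fset ->
  (forall n k, n \in A -> k \in (F `\` A)%fset -> M (f k) < M (f n)) ->
  (forall n k, n \in A -> k \in D -> M (d k) < M (f n)) ->
  (forall n, n \in A -> 0 < M (f n)) ->
  N (lincomb e D d) <= (rho + 1) * (C * N (lincomb e F f)).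
Proof.
move=> [DF farD] A0 DA AF ff df f0; set z := lincomb e F f.
(* The competitor that removes [d] has at most [|A|] terms and leaves [z]. *)
have [|c cP] := @semi_greedy_strict (z + lincomb e D d) A D d A0 DA.
  move=> n k nA kA; have nF := fsubsetP AF _ nA.
  have nD : n \notin D by apply: contraL nF => /DF.
  rewrite !linearD /= !coef_lincomb nF (negPf nD) addr0.
  case: (boolP (k \in D)) => kD; first by rewrite (negPf (DF _ kD)) add0r df.
  rewrite addr0; case: (boolP (k \in F)) => kF; last by rewrite nrm0 f0.
  by rewrite ff // in_fsetD kA.
rewrite addrK in cP.
pose g n := f n - if n \in A then c n else 0.
have zg : z - lincomb e A c = lincomb e F g.
  apply: eq_coef => j; rewrite linearB /= !coef_lincomb /g.
  case: (boolP (j \in F)) => // jF; rewrite ifN ?subrr //.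
  by apply: contra jF; apply: (fsubsetP AF).
set w := z + lincomb e D d - lincomb e A c in cP.
have wE : w = lincomb e F g + lincomb e D d by rewrite -zg addrAC.
have le1 := farD g d; rewrite -wE in le1.
(* The part of the remainder [w] on [F] is at most [rho * N w], so subtracting it costs the factor
   [rho + 1]. *)
have -> : lincomb e D d = w - lincomb e F g by rewrite wE addrAC subrr add0r.
apply: le_trans (nrmB _ _) _; rewrite addrC.
apply: (@le_trans _ _ ((rho + 1) * N w)); first by rewrite mulrDl mul1r lerD.
by rewrite ler_pM2l // addr_gt0.
Qed.

Lemma semi_greedy_super_democratic : disjoint_super_democratic re e.
Proof.
exists (rho * (C * ((rho + 1) * (C * 3)))).
  by do ?[apply: addr_gt0 | apply: mulr_gt0].
move=> A B eps eps' AB _ eps1 eps1'.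
have [A0|A0] := posnP #|` A|.
  rewrite (cardfs0_eq A0) [lincomb _ fset0 _]big_seq_fset0 nrm0.
  apply: mulr_ge0 (nrm_ge0 _); apply: ltW.
  by do ?[apply: addr_gt0 | apply: mulr_gt0].
have [D [DA farA farB]] := far_exists (leqnn _) AB.
have M2 : M 2 = 2 by rewrite -(rmorph_nat ofR) nrm_ofR ger0_norm.
have M3 : M 3 = 3 by rewrite -(rmorph_nat ofR) nrm_ofR ger0_norm.
(* The heights [1] on [A], [2] on [D] and [3] on [B] make [D] greedy against [A], and [B] against
   [D]. The competitor removes the part on [A]. *)
have := @semi_greedy_far A A D eps eps (fun=> 2) farA; rewrite DA.
move=> /(_ A0 (leqnn _)) le1; apply: le_trans (le1 _ _) _ => [n k _ _|n _|].
- by rewrite M2 nrm_unit // ltr1n.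
- by rewrite M2.
rewrite addrAC subrr add0r -!mulrA !ler_pM2l //.
have := @semi_greedy_near B B D (fun n => 3 * eps' n) (fun=> 2) farB.
rewrite DA lincombZ nrmZ M3 !mulrA => /(_ (leq_trans A0 AB) AB (fsubset_refl _)).
apply=> [n k _|n k _ _|n _]; last 2 first.
- by rewrite nrmM M3 M2 nrm_unit // mulr1 ltr_nat.
- by rewrite nrmM M3 nrm_unit // mulr1.
by rewrite fsetDv in_fset0.
Qed.

(** The summand [1] covers the case of an empty greedy set. *)
Let Cq := rho * (C * (1 + (rho + 1) * C)) + 1.

Let Cq0 : 0 < Cq.
Proof. by do ?[apply: addr_gt0 | apply: mulr_gt0]. Qed.

Lemma semi_greedy_quasi_greedy_finite (F A : {fset nat}) (f : nat -> K) alpha :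
  let x := lincomb e F f in 0 < alpha ->
  (forall n, n \in A -> alpha < coef x n) ->
  (forall n, n \notin A -> coef x n < alpha) ->
  N (x - proj A x) <= Cq * N x.
Proof.
move=> x alpha0 inA outA.
have [A0|A0] := posnP #|` A|.
  rewrite (cardfs0_eq A0) [proj _ _]big_seq_fset0 subr0 ler_peMl ?nrm_ge0 //.
  rewrite lerDr; apply: ltW.
  by do ?[apply: addr_gt0 | apply: mulr_gt0].
have AF : (A `<=` F)%fset.
  apply/fsubsetP => n /inA; rewrite coef_lincomb; case: ifP => // _.
  by rewrite nrm0 => /(lt_trans alpha0); rewrite ltxx.
have [D [DA farF _]] := far_exists (fsubset_leq_card AF) (fsubset_leq_card AF).
pose d (n : nat) := ofR alpha.
have Md n : M (d n) = alpha by rewrite nrm_ofR gtr0_norm.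
have xf n : n \in F -> es n x = f n by move=> nF; rewrite coef_lincomb nF.
pose g n := if n \in A then 0 else f n.
have xg : x - proj A x = lincomb e F g.
  apply: eq_coef => j; rewrite linearB /= coef_proj !coef_lincomb /g.
  by case: (j \in A); case: (j \in F); rewrite ?subrr ?subr0.
(* The competitor [- proj A x] restores the part of [x] on [A]. *)
have far_le : N (x - proj A x) <= rho * (C * N (x + lincomb e D d)).
  have := @semi_greedy_far F A D g (fun n => - es n x) d farF.
  rewrite DA -xg => /(_ A0 (leqnn _)) le; apply: le_trans (le _ _) _.
  - move=> n k _ kF; rewrite Md /g; case: ifPn => [_|kA]; first by rewrite nrm0.
    by rewrite -xf // outA.
  - by move=> n _; rewrite Md.
  rewrite !ler_pM2l // (_ : _ - lincomb _ _ _ = x + lincomb e D d) //.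
  have -> : lincomb e A (fun n => - es n x) = - proj A x.
    apply: eq_coef => j; rewrite linearN /= coef_proj coef_lincomb.
    by case: ifP; rewrite ?oppr0.
  by rewrite opprK addrAC subrK.
have near_le : N (lincomb e D d) <= (rho + 1) * (C * N x).
  apply: (semi_greedy_near farF A0) => //; first by rewrite DA.
  - move=> n k nA; rewrite in_fsetD => /andP[kA kF].
    rewrite -!xf //; last exact: (fsubsetP AF).
    exact: lt_trans (outA _ kA) (inA _ nA).
  - by move=> n k nA _; rewrite Md -xf ?inA // (fsubsetP AF).
  - by move=> n nA; rewrite -xf ?(lt_trans alpha0) ?inA // (fsubsetP AF).
apply: le_trans far_le _.
apply: (@le_trans _ _ (rho * (C * ((1 + (rho + 1) * C) * N x)))).
  rewrite !ler_pM2l //; apply: le_trans (nrmD _ _) _.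
  by rewrite mulrDl mul1r lerD2l -mulrA.
by rewrite !mulrA ler_wpM2r ?nrm_ge0 // /Cq !mulrA lerDl ler01.
Qed.

(* Enlarging the coefficients of x on A makes A a strict greedy set, which
   survives a small perturbation to a finitely supported vector. *)
Lemma semi_greedy_quasi_greedy : quasi_greedy re e es.
Proof.
exists Cq => // x m _ m0 [A xA ->].
have [_ [alpha [alpha0 inA outA]]] := greedy_set_level xA.
rewrite -/(proj A x).
have [c c0 cle] := coef_le.
(* This crude bound for [proj A] depends on [A], but it only multiplies an error that vanishes with
   [eta]. *)
pose P := \sum_(n <- A) c * N (e n).
have P0 : 0 <= P by apply: sumr_ge0 => n _; rewrite mulr_ge0 ?nrm_ge0 // ltW.
have projP z : N (proj A z) <= P * N z.
  apply: le_trans (nrm_sum _ _ _) _; rewrite mulr_suml; apply: ler_sum => n _.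
  by rewrite nrmZ mulrAC ler_wpM2r ?nrm_ge0.
pose S := lincomb e A (fun n => sgnK (es n x)).
have key eta : 0 < eta ->
    N (x - proj A x) <= Cq * N x + (Cq + 1 + P) * (N S + 1) * eta.
  move=> eta0; pose x1 := x + ofR eta *: S.
  have x1in n : n \in A -> coef x1 n = coef x n + eta.
    move=> nA; rewrite linearD linearZ /= coef_lincomb nA.
    rewrite -{1}(sgnK_mul (es n x)) -mulrDl -rmorphD nrmM nrm_sgnK mulr1.
    by rewrite nrm_ofR ger0_norm // addr_ge0 ?nrm_ge0 // ltW.
  have x1out n : n \notin A -> coef x1 n = coef x n.
    by move=> nA; rewrite linearD linearZ /= coef_lincomb (negPf nA) scaler0 addr0.
  (* The first term controls the distance to [x1]; the second moves each coefficient by less than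
     [eta / 2], so [alpha + eta / 2] still separates [A] from its complement. *)
  have e0 : 0 < Num.min eta (eta / 2 / c) by rewrite lt_min eta0 !divr_gt0.
  have [F [f]] := dense_lincomb x1 e0; set x2 := lincomb e F f.
  rewrite lt_min => /andP[x12 x12'].
  have cx12 n : N (es n x1 - es n x2) < eta / 2.
    rewrite -linearB; apply: le_lt_trans (cle _ _) _.
    by rewrite mulrC -ltr_pdivlMr.
  have fin : N (x2 - proj A x2) <= Cq * N x2.
    apply: (@semi_greedy_quasi_greedy_finite F A f (alpha + eta / 2)).
    - by rewrite ltr_wpDl // divr_gt0.
    - move=> n nA; have := nrmBB (es n x1) (es n x2).
      have := cx12 n; have := inA _ nA; rewrite x1in //.
      rewrite -/x2; lra.
    - move=> n nA; have := nrmBB (es n x2) (es n x1); rewrite nrm_distC.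
      have := cx12 n; have := outA _ nA; rewrite x1out // -/x2; lra.
  have xx2 : N (x - x2) <= (N S + 1) * eta.
    apply: le_trans (nrm_subD x1 _ _) _; rewrite mulrDl mul1r lerD //; last exact: ltW.
    by rewrite opprD addrA subrr add0r nrmN nrmZ nrm_ofR gtr0_norm // mulrC.
  (* By linearity of [proj A], passing from [x2] back to [x] costs a multiple of [N (x - x2)]. *)
  have -> : x - proj A x = (x2 - proj A x2) + ((x - x2) - proj A (x - x2)).
    by rewrite projB opprB addrACA subrKC addKr.
  apply: le_trans (nrmD _ _) _.
  have x2le : N x2 <= N x + N (x - x2).
    by rewrite -lerBlDl nrm_distC nrmBB.
  apply: (@le_trans _ _ (Cq * N x + (Cq + 1 + P) * N (x - x2))).
    have := nrmB (x - x2) (proj A (x - x2)); have := projP (x - x2).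
    have : Cq * N x2 <= Cq * (N x + N (x - x2)) by rewrite ler_pM2l.
    lra.
  by rewrite lerD2l -mulrA ler_wpM2l // addr_ge0 // addr_ge0 // ltW.
have CP0 : 0 < Cq + 1 + P by rewrite ltr_wpDr // addr_gt0.
have S0 : 0 < N S + 1 by rewrite ltr_wpDl ?nrm_ge0.
have B0 := mulr_gt0 CP0 S0.
apply/ler_addgt0Pr => eps eps0; apply: le_trans (key _ (divr_gt0 eps0 B0)) _.
by rewrite [_ * (eps / _)]mulrC divfK ?gt_eqF.
Qed.

End SemiGreedy.
End Basis.
End Norm.

Theorem theorem5p3 (R : realType) (K : numFieldType) (re : K -> R)
    (hK : real_or_complex re)
    (X : completeNormedModType K)
    (e : nat -> X) (es : nat -> {linear X -> K^o})
    (he : is_basis re e es)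
    (rho : R) (hrho : 1 <= rho) (hadm : admissible re e rho) :
  semi_greedy re e es <->
  quasi_greedy re e es /\ disjoint_super_democratic re e.
Proof.
have [ofR [re_ofR ofR_norm ofR_le]] := real_embedding hK.
split=> [[C C0 sg]|[qg dsd]].
  split.
    exact: (semi_greedy_quasi_greedy re_ofR ofR_norm ofR_le he hK hrho hadm C0 sg).
  exact: (semi_greedy_super_democratic re_ofR ofR_norm ofR_le he hK hrho hadm C0 sg).
exact: (quasi_greedy_super_democratic_semi_greedy re_ofR ofR_norm ofR_le he qg dsd).
Qed.
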